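(* Consider the AC optimal transmission switching problem (OTS) and the OTS algorithm described in the context. Suppose that, for every topology $x$, $OPF(x)$ returns a globally optimal solution (that is, $OPF(x)$ is the global optimal value of OTS with its binary vector fixed to $x$), that $\epsilon=0$, and that $T_2=\infty$. Then the algorithm converges to the optimal solution of OTS in finitely many iterations; that is, Phase II stops after finitely many iterations with $UB=z^*$, where $z^*$ is the optimal value of OTS, and the recorded solution attaining $UB$ is an optimal solution of OTS.
   Context: **Network data.** A power network $(\mathcal{B},\mathcal{L})$ has a finite set of buses $\mathcal{B}$, a finite set of lines $\mathcal{L}$, and generator buses $\mathcal{G}\subseteq\mathcal{B}$; $\delta(i)$ is the set of neighbors of bus $i$. Data: real numbers $G_{ij}=G_{ji}$, $B_{ij}=B_{ji}$ for each line, shunt parameters $g_{ii},b_{ii}$, loads $p_i^d,q_i^d$, voltage bounds $\underline V_i,\overline V_i$ with $0<\underline V_i\le\overline V_i$, generation bounds $p_i^{\min},p_i^{\max},q_i^{\min},q_i^{\max}$, line limits $S_{ij}^{\max}$, and cost functions $C_i$ (linear or convex quadratic). At buses without a generator $p_i^g=q_i^g=0$. Flow constraints ''for $(i,j)\in\mathcal{L}$'' are imposed for both orientations of a line; there is a single binary variable per line, $x_{ij}=x_{ji}$. **OTS (exact problem).** Minimize $\sum_{i\in\mathcal{G}}C_i(p_i^g)$ over $p^g,q^g,p,q,c,s,\theta,x$ subject to - for $i\in\mathcal{B}$: $p_i^g-p_i^d=g_{ii}c_{ii}+\sum_{j\in\delta(i)}p_{ij}$, $\;q_i^g-q_i^d=-b_{ii}c_{ii}+\sum_{j\in\delta(i)}q_{ij}$,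 $\;\underline V_i^2\le c_{ii}\le\overline V_i^2$; - for $i\in\mathcal{G}$: $p_i^{\min}\le p_i^g\le p_i^{\max}$, $\;q_i^{\min}\le q_i^g\le q_i^{\max}$; - for $(i,j)\in\mathcal{L}$: $p_{ij}^2+q_{ij}^2\le(S_{ij}^{\max})^2$, $\;c_{ij}=c_{ji}$, $\;s_{ij}=-s_{ji}$, $\;x_{ij}\in\{0,1\}$; - for $(i,j)\in\mathcal{L}$: $p_{ij}=(-G_{ij}c_{ii}+G_{ij}c_{ij}-B_{ij}s_{ij})x_{ij}$, $\;q_{ij}=(B_{ij}c_{ii}-B_{ij}c_{ij}-G_{ij}s_{ij})x_{ij}$; - for $(i,j)\in\mathcal{L}$: $(c_{ij}^2+s_{ij}^2-c_{ii}c_{jj})x_{ij}=0$, $\;(\theta_j-\theta_i-\operatorname{atan2}(s_{ij},c_{ij}))x_{ij}=0$. Its optimal value is $z^*$ ($+\infty$ if infeasible). A topology is a binary vector $x$. $OPF(x)$ denotes the objective value of a feasible solution of OTS with the binary vector fixed to $x$ ($+\infty$ if none is found or none exists). **MISOCP relaxation.** Let $\underline c_{ii}=\underline V_i^2$, $\overline c_{ii}=\overline V_i^2$, and let $\underline c_{ij},\overline c_{ij},\underline s_{ij},\overline s_{ij}$ be finite bounds on $c_{ij},s_{ij}$ valid for every OTS-feasible solution in which line $(i,j)$ is on. In the relaxation $c_{ij},s_{ij}$ take the same values as before when the line is on and $0$ when it is off, and there are additional variables $c_{ii}^j$ (representing $c_{ii}x_{ij}$). Minimize $\sum_{i\in\mathcal{G}}C_i(p_i^g)$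 subject to the first three groups of constraints above together with, for $(i,j)\in\mathcal{L}$, - $p_{ij}=-G_{ij}c_{ii}^j+G_{ij}c_{ij}-B_{ij}s_{ij}$, $\;q_{ij}=B_{ij}c_{ii}^j-B_{ij}c_{ij}-G_{ij}s_{ij}$; - $\underline c_{ij}x_{ij}\le c_{ij}\le\overline c_{ij}x_{ij}$, $\;\underline s_{ij}x_{ij}\le s_{ij}\le\overline s_{ij}x_{ij}$, $\;\underline c_{ii}x_{ij}\le c_{ii}^j\le\overline c_{ii}x_{ij}$; - $c_{ii}-\overline c_{ii}(1-x_{ij})\le c_{ii}^j\le c_{ii}-\underline c_{ii}(1-x_{ij})$; - $c_{ij}^2+s_{ij}^2\le c_{ii}^jc_{jj}^i$. $MISOCP(\mathcal{V},\mathcal{F})$ is this relaxation with additionally a finite set $\mathcal{V}$ of linear inequalities in $(c,s,x)$ and, for each forbidden topology $x^*\in\mathcal{F}$, the no-good cut $\sum_{(i,j):x^*_{ij}=1}(1-x_{ij})+\sum_{(i,j):x^*_{ij}=0}x_{ij}\ge1$. $SOCP(\mathcal{V})$ is the continuous relaxation ($0\le x_{ij}\le1$) of $MISOCP(\mathcal{V},\emptyset)$. **OTS algorithm.** Inputs $T_1,T_2,\epsilon$. *Phase I:* set $\mathcal{V}=\emptyset$, $\mathcal{F}=\emptyset$, $UB=\infty$. For $\tau=1,\dots,T_1$: solve $SOCP(\mathcal{V})$; for each cycle in a cycle basis of the network, separate inequalities cutting off its solution, giving a finite set $\mathcal{V}_\tau$; set $\mathcal{V}\leftarrow\mathcal{V}\cup\mathcal{V}_\tau$.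 All separated inequalities are valid for OTS: every OTS-feasible solution, with $c_{ij},s_{ij}$ set to $0$ on lines that are off, satisfies them. *Phase II:* set $t=0$ and repeat: $t\leftarrow t+1$; solve $MISOCP(\mathcal{V},\mathcal{F})$, obtaining its optimal value $LB_t$ and the set $\mathcal{P}_t$ of all integral solutions (topologies) found by the solver, which includes the topology of an optimal solution (if $MISOCP(\mathcal{V},\mathcal{F})$ is infeasible, $LB_t=+\infty$ and $\mathcal{P}_t=\emptyset$); for each $x\in\mathcal{P}_t$, if $OPF(x)<UB$ set $UB\leftarrow OPF(x)$ and record the corresponding solution; set $\mathcal{F}\leftarrow\mathcal{F}\cup\mathcal{P}_t$; until $LB_t\ge(1-\epsilon)UB$ or $t\ge T_2$. If OTS is infeasible, $UB=z^*=+\infty$ and there is no recorded solution. *)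

(* Defs.v *)
From Stdlib Require List.
From mathcomp Require Import all_boot all_order all_algebra.
From mathcomp Require Import all_classical all_reals all_analysis.

Set Implicit Arguments.
Unset Strict Implicit.
Unset Printing Implicit Defensive.

Import Order.TTheory GRing.Theory Num.Theory.
Local Open Scope ring_scope.

(* Two-argument arctangent, with values in ]-pi, pi]; the value at (0, 0) is a
   convention, never reached on a line that is on, where
   c_ij^2 + s_ij^2 = c_ii c_jj > 0. *)
Definition atan2 (R : realType) (y x : R) : R :=
  if 0 < x then atan (y / x)
  else if x < 0 then
    (if 0 <= y then atan (y / x) + pi else atan (y / x) - pi)
  else if 0 < y then pi / 2
  else if y < 0 then - (pi / 2)
  else 0.

(* A line is the unordered pair of its two (distinct) end buses.  Values of the
   line data outside the pairs (i, j) of adjacent buses are never used. *)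
Record network (R : realType) := Network {
  bus : finType;
  lines : {set {set bus}};
  lines_card2 : forall e, e \in lines -> #|e| = 2;
  gens : {set bus};
  condG : bus -> bus -> R;
  condG_sym : forall i j, [set i; j] \in lines -> condG i j = condG j i;
  suscB : bus -> bus -> R;
  suscB_sym : forall i j, [set i; j] \in lines -> suscB i j = suscB j i;
  gsh : bus -> R;
  bsh : bus -> R;
  pd : bus -> R;
  qd : bus -> R;
  Vmin : bus -> R;
  Vmax : bus -> R;
  Vmin_gt0 : forall i, 0 < Vmin i;
  Vmin_le_Vmax : forall i, Vmin i <= Vmax i;
  pmin : bus -> R;
  pmax : bus -> R;
  qmin : bus -> R;
  qmax : bus -> R;
  Smax : bus -> bus -> R;
  cost : bus -> R -> R;
  cost_quadratic : forall i, i \in gens -> exists a b d : R,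
    0 <= a /\ forall u, cost i u = a * u ^+ 2 + b * u + d
}.

Section OTS.
Variables (R : realType) (N : network R).
Local Notation bus := (bus N).

Definition line : finType := {e : {set bus} | e \in lines N}.

Definition nbr (i : bus) : {set bus} := [set j | [set i; j] \in lines N].

Definition orients (l : line) (i j : bus) : Prop := val l = [set i; j].

Definition topology : finType := {ffun line -> bool}.

(* The variables common to OTS and to its relaxations; vc i i is c_ii. *)
Record op_point := OpPoint {
  pg : bus -> R;
  qg : bus -> R;
  vp : bus -> bus -> R;
  vq : bus -> bus -> R;
  vc : bus -> bus -> R;
  vs : bus -> bus -> R;
  vx : line -> R
}.

Definition objective (u : op_point) : R := \sum_(i in gens N) cost i (pg u i).

Definition has_topology (u : op_point) (x : topology) : Prop :=
  forall l, vx u l = (x l)%:R.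

Definition bus_constraints (u : op_point) : Prop := forall i,
  [/\ pg u i - pd i = gsh i * vc u i i + \sum_(j in nbr i) vp u i j,
      qg u i - qd i = - bsh i * vc u i i + \sum_(j in nbr i) vq u i j &
      Vmin i ^+ 2 <= vc u i i <= Vmax i ^+ 2].

Definition gen_constraints (u : op_point) : Prop :=
  (forall i, i \in gens N ->
     pmin i <= pg u i <= pmax i /\ qmin i <= qg u i <= qmax i) /\
  (forall i, i \notin gens N -> pg u i = 0 /\ qg u i = 0).

Definition line_constraints (u : op_point) : Prop := forall l i j, orients l i j ->
  [/\ vp u i j ^+ 2 + vq u i j ^+ 2 <= Smax i j ^+ 2,
      vc u i j = vc u j i & vs u i j = - vs u j i].

Definition base_constraints (u : op_point) : Prop :=
  [/\ bus_constraints u, gen_constraints u & line_constraints u].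

Definition binary (u : op_point) : Prop := forall l, vx u l = 0 \/ vx u l = 1.

Record ots_solution := OtsSolution {
  ots_point :> op_point;
  theta : bus -> R
}.

Definition ots_feasible (z : ots_solution) : Prop :=
  [/\ base_constraints z, binary z &
    forall l i j, orients l i j ->
    [/\ vp z i j = (- condG i j * vc z i i + condG i j * vc z i j
                    - suscB i j * vs z i j) * vx z l,
        vq z i j = (suscB i j * vc z i i - suscB i j * vc z i j
                    - condG i j * vs z i j) * vx z l,
        (vc z i j ^+ 2 + vs z i j ^+ 2 - vc z i i * vc z j j) * vx z l = 0 &
        (theta z j - theta z i - atan2 (vs z i j) (vc z i j)) * vx z l = 0]].

Definition ots_optimal (z : ots_solution) : Prop :=
  ots_feasible z /\ forall z', ots_feasible z' -> objective z <= objective z'.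

(* z^*; the infimum of the empty set is +oo *)
Definition ots_value : \bar R :=
  ereal_inf [set (objective (ots_point z))%:E | z in ots_feasible]%classic.

(* OPF x = None when no feasible solution with binary vector x is found.  Being
   global includes that the optimum for x is attained whenever x is feasible:
   this can fail in general, atan2 being discontinuous. *)

Definition opf_sound (OPF : topology -> option ots_solution) : Prop :=
  forall x z, OPF x = Some z -> ots_feasible z /\ has_topology z x.

Definition opf_global (OPF : topology -> option ots_solution) : Prop :=
  forall x, match OPF x with
  | Some z => forall z', ots_feasible z' -> has_topology z' x ->
                objective z <= objective z'
  | None => forall z', ots_feasible z' -> ~ has_topology z' x
  end.

Definition opf_value (OPF : topology -> option ots_solution) (x : topology) :
  \bar R := if OPF x is Some z then (objective z)%:E else +oo%E.

Record bounds := Bounds {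
  c_lo : bus -> bus -> R;
  c_hi : bus -> bus -> R;
  s_lo : bus -> bus -> R;
  s_hi : bus -> bus -> R
}.

Definition valid_bounds (b : bounds) : Prop :=
  forall z, ots_feasible z -> forall l i j, orients l i j -> vx z l = 1 ->
    c_lo b i j <= vc z i j <= c_hi b i j /\ s_lo b i j <= vs z i j <= s_hi b i j.

(* cj i j is c_ii^j *)
Record rel_solution := RelSolution {
  rel_point :> op_point;
  cj : bus -> bus -> R
}.

Definition rel_constraints (b : bounds) (u : rel_solution) : Prop :=
  base_constraints u /\
  forall l i j, orients l i j ->
    [/\ vp u i j = - condG i j * cj u i j + condG i j * vc u i j
                   - suscB i j * vs u i j /\
        vq u i j = suscB i j * cj u i j - suscB i j * vc u i j
                   - condG i j * vs u i j,
        c_lo b i j * vx u l <= vc u i j <= c_hi b i j * vx u l /\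
        s_lo b i j * vx u l <= vs u i j <= s_hi b i j * vx u l,
        Vmin i ^+ 2 * vx u l <= cj u i j <= Vmax i ^+ 2 * vx u l,
        vc u i i - Vmax i ^+ 2 * (1 - vx u l) <= cj u i j
          <= vc u i i - Vmin i ^+ 2 * (1 - vx u l) &
        vc u i j ^+ 2 + vs u i j ^+ 2 <= cj u i j * cj u j i].

(* A linear inequality in (c, s, x); only the variables c_ii, and c_ij and s_ij
   for adjacent i and j, can occur. *)
Record lin_ineq := LinIneq {
  coef_cd : bus -> R;
  coef_c : bus -> bus -> R;
  coef_s : bus -> bus -> R;
  coef_x : line -> R;
  rhs : R
}.

Definition lin_lhs (a : lin_ineq) (c s : bus -> bus -> R) (x : line -> R) : R :=
  \sum_i coef_cd a i * c i i
  + \sum_i \sum_(j in nbr i) (coef_c a i j * c i j + coef_s a i j * s i j)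
  + \sum_l coef_x a l * x l.

Definition lin_holds (a : lin_ineq) (c s : bus -> bus -> R) (x : line -> R) :=
  lin_lhs a c s x <= rhs a.

Definition switched (x : line -> R) (w : bus -> bus -> R) (i j : bus) : R :=
  if [exists l : line, (val l == [set i; j]) && (x l == 0)] then 0 else w i j.

Definition valid_ineq (a : lin_ineq) : Prop := forall z, ots_feasible z ->
  lin_holds a (switched (vx z) (vc z)) (switched (vx z) (vs z)) (vx z).

Definition ineqs_hold (V : seq lin_ineq) (u : op_point) : Prop :=
  forall a, List.In a V -> lin_holds a (vc u) (vs u) (vx u).

Definition no_good_cut (y : topology) (x : line -> R) : Prop :=
  \sum_(l | y l) (1 - x l) + \sum_(l | ~~ y l) x l >= 1.

Definition misocp_feasible (b : bounds) (V : seq lin_ineq) (F : {set topology})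
    (u : rel_solution) : Prop :=
  [/\ rel_constraints b u, binary u, ineqs_hold V u &
      forall y, y \in F -> no_good_cut y (vx u)].

Definition socp_feasible (b : bounds) (V : seq lin_ineq) (u : rel_solution) :
    Prop :=
  [/\ rel_constraints b u, forall l, 0 <= vx u l <= 1 & ineqs_hold V u].

Definition rel_optimal (S : rel_solution -> Prop) (u : rel_solution) : Prop :=
  S u /\ forall u', S u' -> objective u <= objective u'.

Definition misocp_value (b : bounds) (V : seq lin_ineq) (F : {set topology}) :
    \bar R :=
  ereal_inf [set (objective (rel_point u))%:E | u in misocp_feasible b V F]%classic.

Definition network_cycle (c : seq bus) : Prop :=
  (2 < size c)%N /\ ucycle (fun i j => j \in nbr i) c.

Definition cycle_vector (c : seq bus) : {ffun line -> ('F_2)^o} :=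
  [ffun l => (has (fun i => val l == [set i; next c i]) c)%:R].

(* a basis, over F_2, of the span of the incidence vectors of the cycles *)
Definition cycle_basis (cs : seq (seq bus)) : Prop :=
  [/\ forall c, c \in cs -> network_cycle c,
      free [seq cycle_vector c | c <- cs] &
      forall c, network_cycle c ->
        cycle_vector c \in <<[seq cycle_vector c | c <- cs]>>%VS].

(* phase1 b cs n V: V can be the set of inequalities held after n rounds, cs
   being the cycle basis used; sep c is the finite set of inequalities separated
   for the cycle c.  When SOCP(V) is infeasible there is no solution to cut
   off. *)
Inductive phase1 (b : bounds) (cs : seq (seq bus)) :
    nat -> seq lin_ineq -> Prop :=
| Phase1_init : phase1 b cs 0 [::]
| Phase1_round n V u (sep : seq bus -> seq lin_ineq) :
    phase1 b cs n V ->
    rel_optimal (socp_feasible b V) u ->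
    (forall c a, c \in cs -> List.In a (sep c) ->
       valid_ineq a /\ ~ lin_holds a (vc u) (vs u) (vx u)) ->
    phase1 b cs n.+1 (V ++ flatten [seq sep c | c <- cs])
| Phase1_infeasible n V :
    phase1 b cs n V ->
    (forall u, ~ socp_feasible b V u) ->
    phase1 b cs n.+1 V.

Record state := State {
  forbidden : {set topology};
  UB : \bar R;
  recorded : option ots_solution
}.

Definition init_state : state := State finset.set0 +oo%E None.

Definition try_topology (OPF : topology -> option ots_solution)
    (w : \bar R * option ots_solution) (x : topology) :=
  if (opf_value OPF x < w.1)%E then (opf_value OPF x, OPF x) else w.

(* the update made with the topologies found by the solver, tried in the order
   of the list P *)
Definition iteration (OPF : topology -> option ots_solution) (st : state)
    (P : seq topology) : state :=
  let w := foldl (try_topology OPF) (UB st, recorded st) P in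
  State (forbidden st :|: [set:: P]) w.1 w.2.

(* the state after t iterations, P k being the result of the solver at
   iteration k >= 1 *)
Fixpoint state_after (OPF : topology -> option ots_solution)
    (P : nat -> seq topology) (t : nat) : state :=
  if t is t'.+1 then iteration OPF (state_after OPF P t') (P t)
  else init_state.

(* P lists, without repetition, a set of topologies that solving MISOCP(V, F)
   can return. *)
Definition misocp_output (b : bounds) (V : seq lin_ineq) (F : {set topology})
    (P : seq topology) : Prop :=
  [/\ uniq P,
      forall x, x \in P -> exists u, misocp_feasible b V F u /\ has_topology u x
    & (exists u, misocp_feasible b V F u) ->
      exists u x, [/\ rel_optimal (misocp_feasible b V F) u,
                      has_topology u x & x \in P]].

Section Phase2.
Variables (b : bounds) (V : seq lin_ineq).
Variables (OPF : topology -> option ots_solution).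
Variables (eps : R) (T2 : option nat). (* T2 = None stands for infinity *)
Variable P : nat -> seq topology.

Definition LB (t : nat) : \bar R :=
  misocp_value b V (forbidden (state_after OPF P t.-1)).

(* the test closing iteration t >= 1 *)
Definition stop_test (t : nat) : Prop :=
  (LB t >= (1 - eps)%:E * UB (state_after OPF P t))%E \/
  (if T2 is Some n then (n <= t)%N else False).

Definition not_stopped_before (t : nat) : Prop :=
  forall k, (0 < k < t)%N -> ~ stop_test k.

(* P records the solver's results in an execution of Phase II: whenever
   iteration t takes place, P t is a result of solving MISOCP(V, F) for the
   current F.  The values of P after the stop are irrelevant. *)
Definition phase2_execution : Prop :=
  forall t, (0 < t)%N -> not_stopped_before t ->
    misocp_output b V (forbidden (state_after OPF P t.-1)) (P t).

Definition stops_at (t : nat) : Prop :=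
  [/\ (0 < t)%N, not_stopped_before t & stop_test t].

End Phase2.
End OTS.

(* Main.v *)
Require Import Defs.
From mathcomp Require Import all_boot all_order all_algebra.
From mathcomp Require Import all_classical all_reals all_analysis.

(** The problem MISOCP(V, F) relaxes the restriction of OTS to the topologies
    outside F: switching off the values of c and s on the open lines of an OTS
    solution turns it into a MISOCP(V, F) solution with the same objective, as
    soon as its topology is not in F ([switch_off_feasible]).  Hence, at every
    iteration, an OTS solution is dominated in one of two ways: if its topology
    is already forbidden, then OPF has been called on it and UB is at most its
    objective ([state_after_correct]); otherwise LB is at most its objective.
    When the algorithm stops with epsilon = 0, we have UB <= LB, so UB is at
    most the objective of every OTS solution ([UB_le_objective]); as UB is +oo
    or the objective of the recorded OTS solution, it is the optimal value.

    The algorithm does stop: an iteration that does not stop has LB < +oo, so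
    MISOCP(V, F) is feasible and the solver returns the topology of a solution,
    which the no-good cuts keep out of F.  The set of forbidden topologies thus
    grows strictly ([forbidden_growth]), within a finite set. *)

Set Implicit Arguments.
Unset Strict Implicit.
Unset Printing Implicit Defensive.

Import Order.TTheory GRing.Theory Num.Theory.
Local Open Scope ring_scope.

Lemma In_cat (T : Type) (a : T) (s1 s2 : seq T) :
  List.In a (s1 ++ s2) -> List.In a s1 \/ List.In a s2.
Proof. by elim: s1 => [|x s1 IH] /=; [right | case=> [->|/IH[]]; tauto]. Qed.

Lemma In_flatten_map (S : eqType) (T : Type) (f : S -> seq T) (s : seq S)
    (a : T) : List.In a (flatten [seq f c | c <- s]) ->
  exists2 c, c \in s & List.In a (f c).
Proof.
elim: s => //= c s IH a_in; case: (In_cat a_in) => [ac|as_].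
  by exists c; rewrite ?mem_head.
by have [d ds ad] := IH as_; exists d; rewrite // inE ds orbT.
Qed.

Section Algorithm.
Context {R : realType} {N : network R}.
Implicit Types (b : bounds N) (V : seq (lin_ineq N)) (F : {set topology N}).
Implicit Types (z : ots_solution N) (u : op_point N) (x y : topology N).

(** * The relaxation *)

Lemma line_neq (l : line N) i j : orients l i j -> i != j.
Proof.
move=> lij; apply/eqP => eij; have := lines_card2 (valP l).
by rewrite lij eij finset.setUid cards1.
Qed.

Lemma switched_diag (X : line N -> R) w i : switched X w i i = w i i.
Proof.
rewrite /switched; case: existsP => // -[l /andP[/eqP lii _]].
by have := line_neq lii; rewrite eqxx.
Qed.

Lemma switched_line (X : line N -> R) w l i j : orients l i j ->
  switched X w i j = if X l == 0 then 0 else w i j.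
Proof.
rewrite /switched => lij; case: existsP => [[k /andP[/eqP kij Xk]]|noff].
  by rewrite -(val_inj (etrans kij (esym lij))) Xk.
by case: eqP => // Xl; case: noff; exists l; rewrite lij Xl !eqxx.
Qed.

(** The MISOCP point of an OTS solution; the third family of switched values
    is c_ii x_ij, the meaning of the additional variables c_ii^j. *)
Definition switch_off (z : ots_solution N) : rel_solution N :=
  RelSolution
    (OpPoint (pg z) (qg z) (vp z) (vq z)
       (switched (vx z) (vc z)) (switched (vx z) (vs z)) (vx z))
    (switched (vx z) (fun i _ => vc z i i)).

Lemma switch_off_base z :
  base_constraints z -> base_constraints (switch_off z).
Proof.
move=> [hb hg hl]; split=> //.
  by move=> i; rewrite /= switched_diag; exact: hb.
move=> l i j lij; have [Sij cij sij] := hl l i j lij.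
have lji : orients l j i by rewrite /orients finset.setUC.
rewrite /= !(switched_line _ _ lij) !(switched_line _ _ lji).
by case: ifP => _; split=> //; rewrite oppr0.
Qed.

Lemma switch_off_rel b z : valid_bounds b -> ots_feasible z ->
  rel_constraints b (switch_off z).
Proof.
move=> bV zf; have [hbase hbin hline] := zf.
split=> [|l i j lij]; first exact: switch_off_base.
have [hp hq hc _] := hline l i j lij.
have [_ _ /andP[cmin cmax]] : _ := let: And3 h _ _ := hbase in h i.
have lji : orients l j i by rewrite /orients finset.setUC.
rewrite /= !(switched_line _ _ lij) !(switched_line _ _ lji) switched_diag.
case: (hbin l) => xl; rewrite xl ?eqxx ?oner_eq0.
  rewrite hp hq xl !(mulr0, subr0, addr0, mulr1, expr0n) lexx /=.
  by rewrite subr_le0 subr_ge0 cmin cmax.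
have [cb sb] := bV z zf l i j lij xl.
rewrite hp hq xl subrr !(mulr0, mulr1, subr0) cb sb cmin cmax lexx.
by split=> //; move: hc; rewrite xl mulr1 => /eqP; rewrite subr_eq0 => /eqP ->.
Qed.

Lemma phase1_valid b cs n V : phase1 b cs n V ->
  forall a, List.In a V -> valid_ineq a.
Proof.
elim=> // {n}{}V w n sep _ IH _ hsep a a_in.
case: (In_cat a_in) => [/IH //|a_sep].
by have [c ccs /(hsep _ _ ccs)[]] := In_flatten_map a_sep.
Qed.

Definition topology_of (u : op_point N) : topology N := [ffun l => vx u l == 1].

Lemma has_topology_of u : binary u -> has_topology u (topology_of u).
Proof.
by move=> ubin l; rewrite ffunE; case: (ubin l) => ->;
  rewrite ?eqxx // eq_sym oner_eq0.
Qed.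

(** On the indicator vector of x, the left-hand side of the cut is the number
    of lines on which x and y differ. *)
Lemma no_good_cutP y u x : has_topology u x ->
  no_good_cut y (vx u) <-> x != y.
Proof.
move=> ux; rewrite /no_good_cut.
have -> : \sum_(l | y l) (1 - vx u l) + \sum_(l | ~~ y l) vx u l
        = (\sum_l (x l != y l))%:R.
  rewrite natr_sum [RHS](bigID (fun l => y l)) /=.
  congr (_ + _); apply: eq_bigr => l yl; rewrite ux.
    by rewrite yl; case: (x l); rewrite ?subrr ?subr0.
  by rewrite (negPf yl); case: (x l).
rewrite ler1n lt0n sum_nat_eq0; split=> [/forallPn[l]|].
  by apply: contraNneq => ->; rewrite eqxx.
apply: contraNN => /forallP xy; apply/eqP/ffunP => l.
by have := xy l; case: (x l); case: (y l).
Qed.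

Lemma switch_off_feasible b V F z :
  valid_bounds b -> (forall a, List.In a V -> valid_ineq a) ->
  ots_feasible z -> topology_of z \notin F ->
  misocp_feasible b V F (switch_off z).
Proof.
move=> bV Vv zf zF; have [_ zbin _] := zf; split=> //.
- exact: switch_off_rel.
- by move=> a /Vv; apply.
move=> y yF; apply/(@no_good_cutP y (switch_off z) (topology_of z)).
  exact: has_topology_of.
by apply: contraNneq zF => ->.
Qed.

Lemma misocp_value_le b V F z :
  valid_bounds b -> (forall a, List.In a V -> valid_ineq a) ->
  ots_feasible z -> topology_of z \notin F ->
  (misocp_value b V F <= (objective z)%:E)%E.
Proof.
move=> bV Vv zf zF; apply: ereal_inf_lbound.
by exists (switch_off z) => //; exact: switch_off_feasible.
Qed.

(** * The upper bound *)

Section SolvingTopologies.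
Variable OPF : topology N -> option (ots_solution N).

Definition incumbent_ok (w : \bar R * option (ots_solution N)) : Prop :=
  if w.2 is Some z then ots_feasible z /\ w.1 = (objective z)%:E
  else w.1 = +oo%E.

(** A topology whose OPF value is +oo never passes the strict test, so the
    recorded solution is never overwritten by None. *)
Lemma try_topology_ok w x : opf_sound OPF ->
  incumbent_ok w -> incumbent_ok (try_topology OPF w x).
Proof.
move=> sound wok; rewrite /try_topology; case: ifP => //.
rewrite /incumbent_ok /opf_value /=; case E: (OPF x) => [z|] //.
by have [] := sound x z E.
Qed.

Lemma try_topology_le w x : ((try_topology OPF w x).1 <= w.1)%E.
Proof. by rewrite /try_topology; case: ifP => // /ltW. Qed.

Lemma try_topology_le_opf w x : ((try_topology OPF w x).1 <= opf_value OPF x)%E.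
Proof. by rewrite /try_topology; case: ltP. Qed.

Lemma foldl_try_le s w : ((foldl (try_topology OPF) w s).1 <= w.1)%E.
Proof.
elim: s w => //= x s IH w; exact: le_trans (IH _) (try_topology_le _ _).
Qed.

Lemma foldl_try_le_opf s w x : x \in s ->
  ((foldl (try_topology OPF) w s).1 <= opf_value OPF x)%E.
Proof.
elim: s w => //= y s IH w; rewrite inE => /predU1P[->|/IH //].
exact: le_trans (foldl_try_le _ _) (try_topology_le_opf _ _).
Qed.

Lemma foldl_try_ok s w : opf_sound OPF ->
  incumbent_ok w -> incumbent_ok (foldl (try_topology OPF) w s).
Proof.
by move=> sound; elim: s w => //= x s IH w wok; apply/IH/try_topology_ok.
Qed.

Lemma state_after_correct (P : nat -> seq (topology N)) t : opf_sound OPF ->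
  let st := state_after OPF P t in
  incumbent_ok (UB st, recorded st) /\
  forall x, x \in forbidden st -> (UB st <= opf_value OPF x)%E.
Proof.
move=> sound; elim: t => [|t [ok le]] /=; first by split=> // x; rewrite inE.
split; first by rewrite -surjective_pairing; exact: foldl_try_ok.
move=> x; rewrite !inE => /orP[/le|]; last exact: foldl_try_le_opf.
by apply: le_trans; exact: foldl_try_le.
Qed.

Lemma opf_value_le z : opf_global OPF -> ots_feasible z ->
  (opf_value OPF (topology_of z) <= (objective z)%:E)%E.
Proof.
move=> glob zf; have [_ zbin _] := zf; have ztop := has_topology_of zbin.
have := glob (topology_of z); rewrite /opf_value.
case: (OPF _) => [z0 /(_ z zf ztop)|/(_ z zf ztop) //].
by rewrite lee_fin.
Qed.

(** LB is computed before the topologies of iteration t are forbidden, and UB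
    after they are tried: splitting on the set forbidden before iteration t
    makes both bounds apply. *)
Lemma UB_le_objective b V P t z :
  valid_bounds b -> (forall a, List.In a V -> valid_ineq a) ->
  opf_sound OPF -> opf_global OPF ->
  (0 < t)%N -> stop_test b V OPF 0 None P t -> ots_feasible z ->
  (UB (state_after OPF P t) <= (objective z)%:E)%E.
Proof.
move=> bV Vv sound glob; case: t => // t _ [|//].
rewrite subr0 mul1e => stop zf.
have [zF|zF] := boolP (topology_of z \in forbidden (state_after OPF P t)).
  have [_ le] := state_after_correct P t.+1 sound.
  apply: le_trans (opf_value_le glob zf); apply: le.
  by rewrite /= finset.in_setU zF.
exact: le_trans stop (misocp_value_le bV Vv zf zF).
Qed.

(** * Termination *)

Lemma misocp_value_infeasible b V F :
  ~ (exists u : rel_solution N, misocp_feasible b V F u) ->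
  misocp_value b V F = +oo%E.
Proof.
move=> infeas; apply/ereal_inf_pinfty => r [u uf _].
by case: infeas; exists u.
Qed.

(** If an iteration does not stop, LB is not +oo, so the solver returns the
    topology of an optimal solution; satisfying the no-good cuts, it is new. *)
Lemma forbidden_growth b V P t : phase2_execution b V OPF 0 None P ->
  (forall k, (0 < k)%N -> ~ stop_test b V OPF 0 None P k) ->
  (t <= #|forbidden (state_after OPF P t)|)%N.
Proof.
move=> exec nostop; elim: t => // t IH; apply: leq_ltn_trans IH _.
have [_ _ new] : misocp_output b V (forbidden (state_after OPF P t)) (P t.+1).
  by apply: (exec t.+1) => // k /andP[k0 _]; exact: nostop.
have /new[u [x [[uf _] ux xP]]] :
    exists u : rel_solution N,
      misocp_feasible b V (forbidden (state_after OPF P t)) u.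
  apply: contrapT => /misocp_value_infeasible infeas.
  by apply: (nostop t.+1) => //; left; rewrite /LB /= infeas leey.
have xF : x \notin forbidden (state_after OPF P t).
  apply/negP => xF; have [_ _ _ /(_ x xF)] := uf.
  by move=> /(no_good_cutP _ ux); rewrite eqxx.
apply: proper_card; apply/properP; split; first exact: finset.subsetUl.
by exists x => //; rewrite !inE xP orbT.
Qed.

Lemma phase2_stops b V P : phase2_execution b V OPF 0 None P ->
  exists t, stops_at b V OPF 0 None P t.
Proof.
move=> exec; pose stop t := (0 < t)%N && `[< stop_test b V OPF 0 None P t >].
have ex_stop : exists t, stop t.
  apply: contrapT => nostop.
  have never k : (0 < k)%N -> ~ stop_test b V OPF 0 None P k.
    move=> k0 kstop; apply: nostop.
    by exists k; rewrite /stop k0; exact/asboolP.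
  have := forbidden_growth #|topology N|.+1 exec never.
  by rewrite leqNgt ltnS max_card.
case: (ex_minnP ex_stop) => t /andP[t0 /asboolP tstop] tmin.
exists t; split=> // k /andP[k0 kt] kstop.
by have := tmin k; rewrite /stop k0 leqNgt kt => /(_ (asboolT kstop)).
Qed.

End SolvingTopologies.
End Algorithm.

Theorem mainTheorem2 (R : realType) (N : network R)
    (b : bounds N) (b_valid : valid_bounds b)
    (cs : seq (seq (bus N))) (cs_basis : cycle_basis cs)
    (OPF : topology N -> option (ots_solution N)) (OPF_sound : opf_sound OPF)
    (T1 : nat) (eps : R) (T2 : option nat)
    (OPF_global : opf_global OPF)
    (eps0 : eps = 0%R) (T2_infinite : T2 = None)
    (V : seq (lin_ineq N)) (V_phase1 : phase1 b cs T1 V)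
    (P : nat -> seq (topology N))
    (P_phase2 : phase2_execution b V OPF eps T2 P) :
  exists T : nat,
    stops_at b V OPF eps T2 P T /\
    UB (state_after OPF P T) = ots_value N /\
    match recorded (state_after OPF P T) with
    | Some z => ots_optimal z /\ (objective z)%:E = UB (state_after OPF P T)
    | None => forall z : ots_solution N, ~ ots_feasible z
    end.
Proof.
subst eps T2; have [T Tstop] := phase2_stops P_phase2.
exists T; split=> //; have [T0 _ Ttest] := Tstop.
have UB_le (z : ots_solution N) : ots_feasible z ->
    (UB (state_after OPF P T) <= (objective z)%:E)%E.
  exact: UB_le_objective b_valid (phase1_valid V_phase1) OPF_sound OPF_global
    T0 Ttest.
have [+ _] := state_after_correct P T OPF_sound.
rewrite /incumbent_ok /=; case: (recorded _) => [z [zf UBz]|UBoo].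
  split; last first.
    by split=> //; split=> // z' /UB_le; rewrite UBz lee_fin.
  apply/eqP; rewrite eq_le; apply/andP; split.
    by apply: le_ereal_inf_tmp => _ [z' z'f <-]; exact: UB_le.
  by rewrite UBz; apply: ereal_inf_lbound; exists z.
have infeas (z : ots_solution N) : ~ ots_feasible z.
  by move=> /UB_le; rewrite UBoo.
split=> //; rewrite UBoo; apply/esym/ereal_inf_pinfty => r [z zf _].
by case: (infeas z).
Qed.
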